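(* Let $\alpha\in(0,1]$ and $\beta\in(1-\alpha,\infty)$, and set $$R_1=\begin{cases}\dfrac{1}{4\alpha-2}, & \beta=\alpha-\frac12,\\[2mm] \dfrac{-(\alpha+\beta)+\sqrt{(\alpha+\beta)^2+(1+2\beta-2\alpha)}}{1+2\beta-2\alpha}, & \beta\neq\alpha-\frac12.\end{cases}$$ Then for every $f\in\mathcal{BA}(\mathbb{D})$ with $f(z)=\sum_{k=0}^\infty a_kz^k$ and $a:=|a_0|$, it holds that $$\alpha|f(z)|+(1-\alpha)a+\beta\sum_{k=1}^{\infty}|a_k||z|^k\le 1\qquad\text{for all } z\in\mathbb{D}\text{ with }|z|=r\le R_1.$$ Moreover, for each such pair $(\alpha,\beta)$ the number $R_1$ is the best possible, i.e. it cannot be replaced by any larger number.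
   Context: $\mathbb{D}=\{z\in\mathbb{C}:|z|<1\}$. $\mathcal{BA}(\mathbb{D})$ is the class of analytic functions $f(z)=\sum_{k=0}^\infty a_kz^k$ on $\mathbb{D}$ with $|f(z)|<1$ for all $z\in\mathbb{D}$. ''Best possible'' means: for every $r$ with $R_1<r<1$ there exist $f\in\mathcal{BA}(\mathbb{D})$ and a point $z$ with $|z|=r$ for which the inequality fails.
   Formalization: In the case β = α − 1/2 the value of R_1 is corrected from 1/(4α − 2) to 1/(4α − 1); the printed value fails, e.g. for α = 1, β = 1/2, f(z) = (1 − 2z)/(2 − z), z = −1/2, where the left side is 21/20. *)

(* Defs.v *)
From Stdlib Require Export Reals.
From Coquelicot Require Export Coquelicot.
Open Scope R_scope.

Definition unit_disk (z : C) : Prop := Cmod z < 1.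

(* Functions are total on C; only their values on the unit disk matter.
   [ex_derive] is taken over the field C, so it is complex differentiability. *)
Definition analytic_on_disk (f : C -> C) : Prop :=
  forall z : C, unit_disk z -> @ex_derive C_AbsRing C_NormedModule f z.

Definition BA (f : C -> C) : Prop :=
  analytic_on_disk f /\ forall z : C, unit_disk z -> Cmod (f z) < 1.

Definition has_expansion (f : C -> C) (a : nat -> C) : Prop :=
  forall z : C, unit_disk z -> @is_pseries C_AbsRing C_NormedModule a z (f z).

(* When [has_expansion f a] and |z| < 1 the series below converges, since a
   power series converges absolutely inside its disk of convergence; so the
   default value of [Series] on divergent series plays no role. *)
Definition bohr_sum (alpha beta : R) (f : C -> C) (a : nat -> C) (z : C) : R :=
  alpha * Cmod (f z) + (1 - alpha) * Cmod (a 0%nat)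
  + beta * Series (fun k : nat => Cmod (a (S k)) * Cmod z ^ S k).

(* The positive solution r (the smaller one if there are two) of
     (1 + 2 beta - 2 alpha) r^2 + 2 (alpha + beta) r - 1 = 0.
   For beta = alpha - 1/2 the equation is linear, with solution
     1 / (2 (alpha + beta)) = 1 / (4 alpha - 1);
   the value 1 / (4 alpha - 2) sometimes printed for this case is a misprint:
   for alpha = 1, beta = 1/2, f(z) = (1 - 2 z) / (2 - z) and z = -1/2, it would
   give [bohr_sum] = 21/20 at |z| = 1 / (4 alpha - 2). *)
Definition bohr_radius (alpha beta : R) : R :=
  if Req_EM_T beta (alpha - 1 / 2)
  then 1 / (4 * alpha - 1)
  else (- (alpha + beta)
        + sqrt ((alpha + beta) ^ 2 + (1 + 2 * beta - 2 * alpha)))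
       / (1 + 2 * beta - 2 * alpha).

(* Main.v *)
Require Import Defs.
From Stdlib Require Import Reals Lra Lia Classical.
From Coquelicot Require Import Coquelicot.
Open Scope R_scope.

(** Write [r = |z|] and [a = |a_0|].  For a unimodular [u], the function [1 - u f] has
    positive real part on the disk, and two classical inequalities for such functions
    suffice.  Carathéodory's inequality, with [u a_0 = a], gives [|a_k| <= 2 (1 - a)]
    for [k >= 1] ([coefficient_bound]).  Harnack's inequality, with [u f(z) = |f(z)|],
    gives [1 - |f(z)| >= (1 - a) (1 - r) / (1 + r)] ([modulus_bound]).  Both are weaker
    than the sharp estimates [|a_k| <= 1 - a^2] and Schwarz-Pick, but they agree with
    those to first order as [a -> 1], which is where the theorem is extremal.  Together
    they bound [1 - bohr_sum] below by
      [(1 - a) (1 - 2 (alpha + beta) r - (1 + 2 beta - 2 alpha) r^2) / (1 - r^2)],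
    and on [0 <= r < 1] the quadratic is nonnegative exactly up to the radius
    ([bohr_radius_sign]).

    Both inequalities come from one fact, proved without integration: if polynomials
    with coefficients [c] and [b] have nonnegative real part on the unit circle, then
    [Re (c_0 b_0 + sum_k c_k conj b_k) >= 0] ([positive_real_part_pairing]), because this
    is twice the mean of the product of the real parts over the roots of unity of a
    large order.  The kernel [1 - conj v z^k] as [b] gives Carathéodory's inequality, the
    Poisson kernel minus its minimum gives Harnack's.  Dilating by [rho < 1] makes the
    partial sums of [1 - u f] converge uniformly on the circle, so that the fact applies
    to them up to an error tending to zero; then [rho -> 1].

    The radius is sharp for the disk automorphisms [(a - z) / (1 - a z)] at [z = - r]
    with [a -> 1]: at such points all the estimates above are equalities to first
    order in [1 - a] ([bohr_radius_sharp]). *)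

(** * Finite sums of complex numbers *)

(** A monomorphic copy of [sum_n], which keeps the summands in [C] and its
    operations [Cplus] and [Cmult], where [ring] and rewriting see them. *)
Definition csum (u : nat -> C) (n : nat) : C := @sum_n C_AbelianMonoid u n.

Lemma csum_0 (u : nat -> C) : csum u 0 = u 0%nat.
Proof. exact (sum_O (G := C_AbelianMonoid) u). Qed.

Lemma csum_ext_loc (u v : nat -> C) (n : nat) :
  (forall k, (k <= n)%nat -> u k = v k) -> csum u n = csum v n.
Proof. exact (sum_n_ext_loc (G := C_AbelianMonoid) u v n). Qed.

Lemma csum_ext (u v : nat -> C) (n : nat) :
  (forall k, u k = v k) -> csum u n = csum v n.
Proof. exact (sum_n_ext (G := C_AbelianMonoid) u v n). Qed.

Lemma csum_S (u : nat -> C) (n : nat) :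
  csum u (S n) = (csum u n + u (S n))%C.
Proof. exact (sum_Sn (G := C_AbelianMonoid) u n). Qed.

Lemma csum_scal_l (c : C) (u : nat -> C) (n : nat) :
  csum (fun k => c * u k)%C n = (c * csum u n)%C.
Proof. exact (sum_n_mult_l (K := C_Ring) c u n). Qed.

Lemma csum_plus (u v : nat -> C) (n : nat) :
  csum (fun k => u k + v k)%C n = (csum u n + csum v n)%C.
Proof. exact (sum_n_plus (G := C_AbelianMonoid) u v n). Qed.

Lemma csum_switch (u : nat -> nat -> C) (m n : nat) :
  csum (fun i => csum (u i) n) m = csum (fun j => csum (fun i => u i j) m) n.
Proof. exact (sum_n_switch (G := C_AbelianMonoid) u m n). Qed.

Lemma csum_conj (u : nat -> C) (n : nat) :
  Cconj (csum u n) = csum (fun k => Cconj (u k)) n.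
Proof.
  induction n as [|n IH]; [now rewrite !csum_0|].
  now rewrite !csum_S, Cplus_conj, IH.
Qed.

Lemma csum_Re (u : nat -> C) (n : nat) :
  Re (csum u n) = sum_n (fun k => Re (u k)) n.
Proof.
  induction n as [|n IH]; [now rewrite csum_0, sum_O|].
  now rewrite csum_S, re_plus, IH, sum_Sn.
Qed.

Lemma csum_eq0 (u : nat -> C) (n : nat) :
  (forall k, (k <= n)%nat -> u k = 0%C) -> csum u n = 0%C.
Proof.
  induction n as [|n IH]; intros H.
  - rewrite csum_0. apply H. lia.
  - rewrite csum_S, IH, H by (intros; try apply H; lia). ring.
Qed.

Lemma csum_single (u : nat -> C) (n m : nat) :
  (m <= n)%nat -> (forall k, (k <= n)%nat -> k <> m -> u k = 0%C) ->
  csum u n = u m.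
Proof.
  induction n as [|n IH]; intros Hm H.
  - replace m with 0%nat by lia. apply csum_0.
  - rewrite csum_S. destruct (Nat.eq_dec m (S n)) as [->|Hne].
    + rewrite csum_eq0 by (intros k Hk; apply H; lia). ring.
    + rewrite IH, (H (S n)) by (intros; try apply H; lia). ring.
Qed.

Lemma csum_first (u : nat -> C) (n : nat) :
  csum u (S n) = (u 0%nat + csum (fun k => u (S k)) n)%C.
Proof.
  induction n as [|n IH].
  - now rewrite csum_S, !csum_0.
  - rewrite csum_S, IH, (csum_S (fun k => u (S k))). ring.
Qed.

Lemma geom_csum (x : C) (n : nat) :
  ((1 - x) * csum (fun k => x ^ k) n = 1 - x ^ S n)%C.
Proof.
  induction n as [|n IH].
  - rewrite csum_0. simpl. ring.
  - rewrite csum_S. rewrite Cmult_plus_distr_l, IH, (Cpow_S x (S n)). ring.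
Qed.

Definition cpoly (c : nat -> C) (n : nat) (z : C) : C :=
  csum (fun k => c k * z ^ k)%C n.

(** * Roots of unity *)

Definition cis (t : R) : C := (cos t, sin t).

Lemma cis_pow (t : R) (n : nat) : (cis t ^ n)%C = cis (INR n * t).
Proof.
  induction n as [|n IH].
  - simpl. unfold cis. now rewrite Rmult_0_l, cos_0, sin_0.
  - rewrite Cpow_S, IH, S_INR. unfold cis.
    replace ((INR n + 1) * t) with (t + INR n * t) by ring.
    rewrite cos_plus, sin_plus. unfold Cmult; simpl. f_equal; ring.
Qed.

Lemma Cmod_cis (t : R) : Cmod (cis t) = 1.
Proof.
  unfold Cmod, cis; simpl.
  replace (cos t * (cos t * 1) + sin t * (sin t * 1)) with 1; [apply sqrt_1|].
  generalize (sin2_cos2 t). unfold Rsqr. lra.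
Qed.

(** Indexed by the predecessor [m] of its order, to match [csum _ m],
    which has [m + 1] terms. *)
Definition root (m : nat) : C := cis (2 * PI / INR (S m)).

Lemma root_order (m : nat) : (root m ^ S m)%C = 1%C.
Proof.
  unfold root. rewrite cis_pow.
  replace (INR (S m) * (2 * PI / INR (S m))) with (2 * PI)
    by (field; apply not_0_INR; lia).
  unfold cis. now rewrite cos_2PI, sin_2PI.
Qed.

(** At an angle [t] strictly between [0] and [2 PI], [cos t = 1 - 2 sin (t/2) ^ 2]
    is less than 1, because the half angle lies in the open interval [(0, PI)]. *)
Lemma root_pow_neq1 (m d : nat) : (0 < d <= m)%nat -> (root m ^ d)%C <> 1%C.
Proof.
  intros [Hd Hdm] H. unfold root in H. rewrite cis_pow in H.
  set (t := INR d * (2 * PI / INR (S m))) in H.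
  assert (Hm : 0 < INR (S m)) by (apply lt_0_INR; lia).
  assert (Hd' : 0 < INR d) by (apply lt_0_INR; lia).
  assert (Hlt : INR d < INR (S m)) by (apply lt_INR; lia).
  assert (Hpi := PI_RGT_0).
  assert (Ht : t = 2 * PI * (INR d / INR (S m))) by (unfold t; field; lra).
  assert (Hq : 0 < INR d / INR (S m) < 1).
  { split; [now apply Rdiv_lt_0_compat|]. apply (Rdiv_lt_1 _ _ Hm). lra. }
  assert (Ht2 : 0 < t / 2 < PI) by (rewrite Ht; split; nra).
  assert (Hs : 0 < sin (t / 2)) by (apply sin_gt_0; lra).
  apply (f_equal fst) in H. simpl in H.
  replace t with (2 * (t / 2)) in H by lra.
  rewrite cos_2a_sin in H. nra.
Qed.

Lemma Cmod_root_pow (m j : nat) : Cmod (root m ^ j)%C = 1.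
Proof. rewrite Cmod_pow. unfold root. now rewrite Cmod_cis, pow1. Qed.

Lemma Cmult_conj_unit (z : C) : Cmod z = 1 -> (z * Cconj z)%C = 1%C.
Proof. intros H. rewrite <- Cmod2_conj, H. now rewrite pow1. Qed.

Lemma root_power_sum (m d : nat) : (0 < d <= m)%nat ->
  csum (fun j => (root m ^ j) ^ d)%C m = 0%C.
Proof.
  intros Hd.
  rewrite (csum_ext _ (fun j => (root m ^ d) ^ j)%C)
    by (intros j; now rewrite <- !Cpow_mult_r, Nat.mul_comm).
  assert (H := geom_csum (root m ^ d)%C m).
  rewrite <- Cpow_mult_r, Nat.mul_comm, Cpow_mult_r, root_order, Cpow_1_l in H.
  assert (Hne : (1 - root m ^ d)%C <> 0%C).
  { intros H0. apply (root_pow_neq1 m d Hd).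
    replace (root m ^ d)%C with (1 - (1 - root m ^ d))%C by ring.
    rewrite H0. ring. }
  transitivity (/ (1 - root m ^ d) * ((1 - root m ^ d) * csum (fun j => (root m ^ d) ^ j) m))%C.
  - now field.
  - rewrite H. ring.
Qed.

Lemma root_orthogonal (m k l : nat) : (k <= m)%nat -> (l <= m)%nat -> k <> l ->
  csum (fun j => (root m ^ j) ^ k * Cconj ((root m ^ j) ^ l))%C m = 0%C.
Proof.
  intros Hk Hl Hkl.
  assert (U : forall j i, (((root m ^ j) ^ i) * Cconj ((root m ^ j) ^ i))%C = 1%C).
  { intros j i. apply Cmult_conj_unit. now rewrite Cmod_pow, Cmod_root_pow, pow1. }
  destruct (Nat.lt_ge_cases k l) as [Hlt|Hge].
  - rewrite (csum_ext _ (fun j => Cconj ((root m ^ j) ^ (l - k)))%C).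
    + rewrite <- csum_conj, root_power_sum by lia.
      unfold Cconj; simpl. now rewrite Ropp_0.
    + intros j. replace l with (k + (l - k))%nat at 1 by lia.
      rewrite Cpow_add_r, Cmult_conj, Cmult_assoc, U. ring.
  - rewrite (csum_ext _ (fun j => (root m ^ j) ^ (k - l))%C).
    + apply root_power_sum; lia.
    + intros j. replace k with ((k - l) + l)%nat at 1 by lia.
      rewrite Cpow_add_r, <- Cmult_assoc, U. ring.
Qed.

Lemma csum_const (c : C) (n : nat) : csum (fun _ => c) n = (INR (S n) * c)%C.
Proof.
  induction n as [|n IH].
  - rewrite csum_0. simpl. ring.
  - rewrite csum_S, IH, (S_INR (S n)), RtoC_plus. ring.
Qed.

(** Discrete Parseval: with more nodes than the degree, no two frequencies
    coincide on the nodes, so the mean of [c * conj b] is computed exactly. *)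
Lemma root_mean_conj (b c : nat -> C) (n m : nat) : (n <= m)%nat ->
  csum (fun j => cpoly c n (root m ^ j) * Cconj (cpoly b n (root m ^ j)))%C m
  = (INR (S m) * csum (fun k => c k * Cconj (b k)) n)%C.
Proof.
  intros Hnm. unfold cpoly.
  rewrite (csum_ext _ (fun j => csum (fun k => csum (fun l =>
     c k * Cconj (b l) * ((root m ^ j) ^ k * Cconj ((root m ^ j) ^ l))) n) n)%C).
  2:{ intros j. rewrite csum_conj, Cmult_comm, <- csum_scal_l.
      apply csum_ext; intros k. rewrite Cmult_comm, <- csum_scal_l.
      apply csum_ext; intros l. rewrite Cmult_conj. ring. }
  rewrite csum_switch, <- csum_scal_l.
  apply csum_ext_loc; intros k Hk. rewrite csum_switch.
  rewrite (csum_single _ n k Hk).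
  - rewrite (csum_ext _ (fun _ => c k * Cconj (b k))%C); [apply csum_const|].
    intros j. rewrite (Cmult_conj_unit ((root m ^ j) ^ k)%C); [ring|].
    now rewrite Cmod_pow, Cmod_root_pow, pow1.
  - intros l Hl Hlk. rewrite csum_scal_l, root_orthogonal by lia. ring.
Qed.

(** Without conjugation the frequencies [k + l] run up to [2 n]; with more nodes
    than that, only the frequency zero survives. *)
Lemma root_mean_mult (b c : nat -> C) (n m : nat) : (2 * n <= m)%nat ->
  csum (fun j => cpoly c n (root m ^ j) * cpoly b n (root m ^ j))%C m
  = (INR (S m) * (c 0%nat * b 0%nat))%C.
Proof.
  intros Hnm. unfold cpoly.
  rewrite (csum_ext _ (fun j => csum (fun k => csum (fun l =>
     c k * b l * (root m ^ j) ^ (k + l)) n) n)%C).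
  2:{ intros j. rewrite Cmult_comm, <- csum_scal_l.
      apply csum_ext; intros k. rewrite Cmult_comm, <- csum_scal_l.
      apply csum_ext; intros l. rewrite Cpow_add_r. ring. }
  rewrite csum_switch, (csum_single _ n 0 (Nat.le_0_l n)).
  - rewrite csum_switch, (csum_single _ n 0 (Nat.le_0_l n)).
    + rewrite (csum_ext _ (fun _ => c 0%nat * b 0%nat)%C); [apply csum_const|].
      intros j. simpl. ring.
    + intros l Hl Hl0. rewrite csum_scal_l, root_power_sum by lia. ring.
  - intros k Hk Hk0. rewrite csum_switch. apply csum_eq0.
    intros l Hl. rewrite csum_scal_l, root_power_sum by lia. ring.
Qed.

(** * The pairing of functions with nonnegative real part *)

Lemma sum_n_nonneg (u : nat -> R) (n : nat) :
  (forall k, (k <= n)%nat -> 0 <= u k) -> 0 <= sum_n u n.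
Proof.
  induction n as [|n IH]; intros H.
  - rewrite sum_O. apply H. lia.
  - rewrite sum_Sn. apply Rplus_le_le_0_compat; [apply IH; intros|]; apply H; lia.
Qed.

(** The product [Re A * Re B] is half the real part of [A * B + A * conj B].  Its
    mean over sufficiently many roots of unity is nonnegative, and the two
    preceding lemmas evaluate that mean.  Choosing one factor as a test kernel turns
    this into estimates for the coefficients and values of the other. *)
Lemma positive_real_part_pairing (b c : nat -> C) (n : nat) :
  (forall z, Cmod z = 1 -> 0 <= Re (cpoly c n z)) ->
  (forall z, Cmod z = 1 -> 0 <= Re (cpoly b n z)) ->
  0 <= Re (c 0%nat * b 0%nat + csum (fun k => c k * Cconj (b k)) n)%C.
Proof.
  intros Hc Hb. set (m := (2 * n)%nat).
  assert (Hm : 0 < INR (S m)) by (apply lt_0_INR; lia).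
  apply (Rmult_le_reg_l _ _ _ Hm). rewrite Rmult_0_r, <- re_scal_l.
  rewrite Cmult_plus_distr_l, <- (root_mean_mult b c n m), <- (root_mean_conj b c n m)
    by lia.
  rewrite <- csum_plus, csum_Re.
  apply sum_n_nonneg; intros j _.
  assert (H1 := Hc _ (Cmod_root_pow m j)). assert (H2 := Hb _ (Cmod_root_pow m j)).
  rewrite re_plus, !re_mult, re_conj, im_conj. nra.
Qed.

(** * Pairing with errors that tend to zero *)

Lemma csum_change_first (u v : nat -> C) (n : nat) :
  (forall k, v (S k) = u (S k)) -> csum v n = (csum u n + (v 0%nat - u 0%nat))%C.
Proof.
  intros H. induction n as [|n IH].
  - rewrite !csum_0. ring.
  - rewrite !csum_S, IH, H. ring.
Qed.

Definition add_constant (d : R) (c : nat -> C) (k : nat) : C :=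
  match k with 0%nat => (c 0%nat + d)%C | S _ => c k end.

Lemma cpoly_add_constant (d : R) (c : nat -> C) (n : nat) (z : C) :
  cpoly (add_constant d c) n z = (cpoly c n z + d)%C.
Proof.
  unfold cpoly. rewrite (csum_change_first (fun k => c k * z ^ k)%C) by reflexivity.
  simpl. ring.
Qed.

(** Truncating a power series costs a small error in the sign of the real part;
    adding the constant [d] to both polynomials restores it. *)
Lemma pairing_perturbed (b c : nat -> C) (d : R) (n : nat) :
  (forall z, Cmod z = 1 -> - d <= Re (cpoly c n z)) ->
  (forall z, Cmod z = 1 -> - d <= Re (cpoly b n z)) ->
  - (2 * d * (Re (b 0%nat) + Re (c 0%nat) + d)) <=
    Re (c 0%nat * b 0%nat + csum (fun k => c k * Cconj (b k)) n)%C.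
Proof.
  intros Hc Hb.
  assert (Shift : forall e, (forall z, Cmod z = 1 -> - d <= Re (cpoly e n z)) ->
            forall z, Cmod z = 1 -> 0 <= Re (cpoly (add_constant d e) n z)).
  { intros e He z Hz. rewrite cpoly_add_constant, re_plus, re_RtoC.
    generalize (He z Hz). lra. }
  assert (H := positive_real_part_pairing _ _ n (Shift c Hc) (Shift b Hb)).
  rewrite (csum_change_first (fun k => c k * Cconj (b k))%C) in H by reflexivity.
  simpl add_constant in H.
  revert H. generalize (csum (fun k => c k * Cconj (b k))%C n).
  destruct (c 0%nat) as [c1 c2], (b 0%nat) as [b1 b2]. intros [s1 s2].
  simpl. intros H. nra.
Qed.

(** For a series converging uniformly on the unit circle this says that the sum has
    nonnegative real part there; stated on partial sums, it needs no sum. *)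
Definition asymptotically_nonneg (c : nat -> C) : Prop :=
  forall eps : R, 0 < eps -> exists n0 : nat, forall n, (n0 <= n)%nat ->
    forall z, Cmod z = 1 -> - eps <= Re (cpoly c n z).

Lemma asymptotic_pairing (b c : nat -> C) (eps : R) :
  asymptotically_nonneg b -> asymptotically_nonneg c -> 0 < eps ->
  exists n0 : nat, forall n, (n0 <= n)%nat ->
    - eps <= Re (c 0%nat * b 0%nat + csum (fun k => c k * Cconj (b k)) n)%C.
Proof.
  intros Hb Hc Heps.
  (* For [d <= 1] the error [2 d (Re b0 + Re c0 + d)] of the perturbed pairing is
     at most [d * M]. *)
  set (M := 2 * (Rabs (Re (b 0%nat)) + Rabs (Re (c 0%nat)) + 1)).
  assert (HM : 2 <= M).
  { generalize (Rabs_pos (Re (b 0%nat))) (Rabs_pos (Re (c 0%nat))). unfold M. lra. }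
  set (d := Rmin 1 (eps / M)).
  assert (Hq : 0 < eps / M) by (apply Rdiv_lt_0_compat; lra).
  assert (Hd : 0 < d <= 1).
  { split; [apply Rmin_glb_lt; lra | apply Rmin_l]. }
  assert (HdM : d * M <= eps).
  { apply Rle_trans with (eps / M * M); [|right; field; lra].
    apply Rmult_le_compat_r; [lra | apply Rmin_r]. }
  destruct (Hb d (proj1 Hd)) as [nb Hnb]. destruct (Hc d (proj1 Hd)) as [nc Hnc].
  exists (nb + nc)%nat. intros n Hn.
  eapply Rle_trans; [|apply (pairing_perturbed b c d n)].
  - apply Ropp_le_contravar. apply Rle_trans with (2 := HdM). unfold M.
    generalize (Rle_abs (Re (b 0%nat))) (Rle_abs (Re (c 0%nat))). nra.
  - apply Hnc. lia.
  - apply Hnb. lia.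
Qed.

(** * Carathéodory's inequality *)

Lemma csum_two_terms (u : nat -> C) (n m : nat) : (0 < m <= n)%nat ->
  (forall k, (0 < k <= n)%nat -> k <> m -> u k = 0%C) ->
  csum u n = (u 0%nat + u m)%C.
Proof.
  intros Hm H. destruct n as [|n]; [lia|]. destruct m as [|m]; [lia|].
  rewrite csum_first, (csum_single _ n m) by (intros; try apply H; lia). ring.
Qed.

Lemma exists_unit_rotation (w : C) : exists v : C, Cmod v = 1 /\ (v * w)%C = Cmod w.
Proof.
  destruct (Ceq_dec w 0%C) as [->|Hw].
  - exists 1%C. rewrite Cmod_1, Cmod_0. split; [reflexivity|ring].
  - assert (Hm := proj1 (Cmod_gt_0 w) Hw).
    exists (Cconj w / Cmod w)%C.
    assert (HmC : RtoC (Cmod w) <> 0%C) by (intros H; apply RtoC_inj in H; lra).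
    split.
    + rewrite Cmod_div, Cmod_conj, Cmod_R, Rabs_pos_eq by (assumption || lra). field. lra.
    + transitivity (RtoC (Cmod w ^ 2) / Cmod w)%C.
      * rewrite Cmod2_conj. field. assumption.
      * rewrite RtoC_pow. field. assumption.
Qed.

(** The test kernel is [1 - conj v * z ^ k], of nonnegative real part on the circle
    as [v] has modulus 1; pairing with it gives [0 <= 2 Re c0 - Re (v * c k)], and
    [v] is chosen to make [v * c k] equal to the modulus of [c k]. *)
Lemma caratheodory_coefficient (c : nat -> C) (k : nat) :
  asymptotically_nonneg c -> (0 < k)%nat -> Cmod (c k) <= 2 * Re (c 0%nat).
Proof.
  intros Hc Hk.
  destruct (exists_unit_rotation (c k)) as [v [Hv Hvc]].
  set (b := fun j => if Nat.eqb j 0 then RtoC 1 else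
                     if Nat.eqb j k then (- Cconj v)%C else RtoC 0).
  assert (Hbk : b k = (- Cconj v)%C).
  { unfold b. rewrite Nat.eqb_refl. now destruct k; [lia|]. }
  assert (Hb0 : forall j, (0 < j)%nat -> j <> k -> b j = RtoC 0).
  { intros j H0 Hj. unfold b. apply Nat.eqb_neq in Hj. rewrite Hj.
    now destruct j; [lia|]. }
  assert (Hb : asymptotically_nonneg b).
  { intros eps Heps. exists k. intros n Hn z Hz. unfold cpoly.
    rewrite (csum_two_terms _ n k) by
      (try lia; intros j H0 Hj; rewrite Hb0 by lia; ring).
    rewrite Hbk. change (b 0%nat) with (RtoC 1). simpl (z ^ 0)%C.
    assert (H := re_le_Cmod (- Cconj v * z ^ k)%C).
    rewrite Cmod_mult, Cmod_opp, Cmod_conj, Hv, Cmod_pow, Hz, pow1, Rmult_1_l in H.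
    apply Rabs_le_between in H. rewrite re_plus, <- RtoC_mult, re_RtoC. lra. }
  apply Rnot_lt_le. intros Hlt.
  destruct (asymptotic_pairing b c ((Cmod (c k) - 2 * Re (c 0%nat)) / 2) Hb Hc ltac:(lra))
    as [n0 Hn0].
  specialize (Hn0 (n0 + k)%nat ltac:(lia)).
  rewrite (csum_two_terms _ (n0 + k) k) in Hn0 by
    (try lia; intros j H0 Hj; rewrite Hb0 by lia; unfold Cconj; simpl;
     rewrite Ropp_0; change (0, 0) with (RtoC 0); ring).
  rewrite Hbk, Copp_conj, Cconj_conj in Hn0. change (b 0%nat) with (RtoC 1) in Hn0.
  replace (c k * - v)%C with (- (Cmod (c k)))%C in Hn0 by (rewrite <- Hvc; ring).
  rewrite !re_plus, re_opp, re_RtoC in Hn0.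
  rewrite re_scal_r, !re_mult, re_conj, im_conj in Hn0. simpl in Hn0. lra.
Qed.

(** * Harnack's inequality *)

Lemma Cconj_RtoC (x : R) : Cconj x = x.
Proof. unfold Cconj, RtoC. simpl. now rewrite Ropp_0. Qed.

(** The real part is the Poisson kernel [(1 - r^2) / |1 - w|^2], and
    [|1 - w| <= 1 + r], where [r = |w|]. *)
Lemma half_plane_map_lower_bound (w : C) : Cmod w < 1 ->
  (1 - Cmod w) / (1 + Cmod w) <= Re ((1 + w) / (1 - w))%C.
Proof.
  intros Hw. assert (H0 := Cmod_ge_0 w). assert (H2 := Cmod2_alt w).
  assert (Hx := re_le_Cmod w). apply Rabs_le_between in Hx.
  destruct w as [x y]. set (r := Cmod (x, y)) in *. simpl in *.
  assert (HD : 0 < (1 - x) * (1 - x) + y * y) by nra.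
  replace ((1 + x) * ((1 + - x) / ((1 + - x) * ((1 + - x) * 1) + (0 + - y) * ((0 + - y) * 1))) -
   (0 + y) * (- (0 + - y) / ((1 + - x) * ((1 + - x) * 1) + (0 + - y) * ((0 + - y) * 1))))
   with ((1 - r * r) / ((1 - x) * (1 - x) + y * y)).
  - apply Rle_div_l; [lra|]. unfold Rdiv. rewrite Rmult_assoc, (Rmult_comm (/ _)), <- Rmult_assoc.
    apply (Rle_div_r _ _ _ HD). nra.
  - replace (r * r) with (x * x + y * y) by lra. field. nra.
Qed.

Lemma Cmod_one_minus (w : C) : 1 - Cmod w <= Cmod (1 - w)%C.
Proof.
  assert (H := Cmod_triangle (1 - w)%C w).
  replace (1 - w + w)%C with (RtoC 1) in H by ring. rewrite Cmod_1 in H. lra.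
Qed.

Lemma C_one_minus_neq0 (w : C) : Cmod w < 1 -> (1 - w)%C <> 0%C.
Proof.
  intros Hw H. assert (H1 := Cmod_one_minus w). rewrite H, Cmod_0 in H1. lra.
Qed.

Lemma geom_csum_closed (w : C) (n : nat) : Cmod w < 1 ->
  csum (fun k => w ^ k)%C n = ((1 - w ^ S n) / (1 - w))%C.
Proof.
  intros Hw. rewrite <- geom_csum. field. now apply C_one_minus_neq0.
Qed.

Lemma pow_eventually_small (t eps : R) : 0 <= t < 1 -> 0 < eps ->
  exists n0, forall n, (n0 <= n)%nat -> t ^ n < eps.
Proof.
  intros Ht Heps.
  destruct (pow_lt_1_zero t ltac:(rewrite Rabs_pos_eq; lra) eps Heps) as [n0 Hn0].
  exists n0. intros n Hn. specialize (Hn0 n Hn). now apply Rabs_lt_between in Hn0.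
Qed.

(** Coefficients in [z] of [(1 + w) / (1 - w)], [w = conj s * z], whose real part on the
    unit circle is the Poisson kernel of [s]; the minimum [(1 - |s|) / (1 + |s|)] of that
    kernel is subtracted. *)
Definition poisson_coefficient (s : C) (k : nat) : C :=
  match k with
  | 0%nat => RtoC (1 - (1 - Cmod s) / (1 + Cmod s))
  | S _ => (2 * Cconj s ^ k)%C
  end.

Lemma poisson_coefficient_nonneg (s : C) : Cmod s < 1 ->
  asymptotically_nonneg (poisson_coefficient s).
Proof.
  intros Hs eps Heps. set (r := Cmod s) in *.
  assert (Hr : 0 <= r) by apply Cmod_ge_0.
  destruct (pow_eventually_small r (eps * (1 - r) / 2) ltac:(lra) ltac:(nra))
    as [n0 Hn0].
  exists n0. intros n Hn z Hz.
  set (w := (Cconj s * z)%C).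
  assert (Hw : Cmod w = r) by (unfold w; rewrite Cmod_mult, Cmod_conj, Hz; apply Rmult_1_r).
  (* The last term is the tail of the geometric series, small for large [n]. *)
  assert (E : cpoly (poisson_coefficient s) n z
     = ((1 + w) / (1 - w) - RtoC ((1 - r) / (1 + r)) + - (2 * (w ^ S n / (1 - w))))%C).
  { unfold cpoly.
    rewrite (csum_change_first (fun k => 2 * w ^ k)%C).
    - rewrite csum_scal_l, geom_csum_closed by lra.
      change (poisson_coefficient s 0) with (RtoC (1 - (1 - r) / (1 + r))).
      rewrite RtoC_minus. simpl (w ^ 0)%C. simpl (z ^ 0)%C.
      field. apply C_one_minus_neq0. lra.
    - intros k. simpl poisson_coefficient. unfold w. rewrite Cpow_mult_l, !Cpow_S. ring. }
  rewrite E, re_plus. unfold Cminus at 1. rewrite re_plus, !re_opp, re_RtoC.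
  assert (H1 := half_plane_map_lower_bound w ltac:(lra)). rewrite Hw in H1.
  assert (H2 := re_le_Cmod (2 * (w ^ S n / (1 - w)))%C).
  rewrite Cmod_mult, Cmod_div, Cmod_pow, Hw, Cmod_R, (Rabs_pos_eq 2) in H2
    by (try apply C_one_minus_neq0; lra).
  apply Rabs_le_between in H2.
  assert (H3 : r ^ S n / Cmod (1 - w)%C <= eps / 2).
  { assert (H4 := Cmod_one_minus w). rewrite Hw in H4.
    apply Rle_div_l; [lra|].
    specialize (Hn0 (S n) ltac:(lia)). nra. }
  lra.
Qed.

(** Harnack's inequality at [s], where the series has sum [l].  Pairing with the
    Poisson kernel minus its minimum [m] gives [0 <= 2 (Re l - m * Re c0)]: the kernel
    reproduces the value at [s]. *)
Lemma harnack (c : nat -> C) (s l : C) :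
  asymptotically_nonneg c -> Cmod s < 1 ->
  (forall eps, 0 < eps -> exists n0, forall n, (n0 <= n)%nat ->
     Cmod (cpoly c n s - l)%C <= eps) ->
  (1 - Cmod s) / (1 + Cmod s) * Re (c 0%nat) <= Re l.
Proof.
  intros Hc Hs Hl. set (m := (1 - Cmod s) / (1 + Cmod s)).
  apply Rnot_lt_le. intros Hlt. set (eps := (m * Re (c 0%nat) - Re l) / 3).
  assert (Heps : 0 < eps) by (unfold eps; lra).
  destruct (asymptotic_pairing _ c eps (poisson_coefficient_nonneg s Hs) Hc Heps)
    as [n1 Hn1].
  destruct (Hl eps Heps) as [n2 Hn2].
  specialize (Hn1 (n1 + n2)%nat ltac:(lia)). specialize (Hn2 (n1 + n2)%nat ltac:(lia)).
  revert Hn1 Hn2. generalize (n1 + n2)%nat. intros n Hn1 Hn2.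
  assert (E : (c 0%nat * poisson_coefficient s 0 +
               csum (fun k => c k * Cconj (poisson_coefficient s k)) n
               = 2 * cpoly c n s - RtoC (2 * m) * c 0%nat)%C).
  { rewrite (csum_change_first (fun k => 2 * (c k * s ^ k))%C).
    - rewrite csum_scal_l. unfold cpoly.
      change (poisson_coefficient s 0) with (RtoC (1 - m)).
      rewrite Cconj_RtoC, RtoC_minus, RtoC_mult. simpl (s ^ 0)%C. ring.
    - intros k. simpl poisson_coefficient.
      rewrite !Cmult_conj, Cpow_conj, Cconj_conj, Cconj_RtoC, Cpow_S. ring. }
  rewrite E in Hn1. unfold Cminus in Hn1. rewrite re_plus, re_opp, !re_scal_l in Hn1.
  assert (H := re_le_Cmod (cpoly c n s - l)%C). apply Rabs_le_between in H.
  unfold Cminus in H, Hn2. rewrite re_plus, re_opp in H.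
  unfold eps in *. lra.
Qed.

(** * Uniform convergence of power series *)

Lemma is_pseries_C_iff (a : nat -> C) (z l : C) :
  @is_pseries C_AbsRing C_NormedModule a z l <->
  forall eps, 0 < eps -> exists n0, forall n, (n0 <= n)%nat ->
    Cmod (cpoly a n z - l)%C < eps.
Proof.
  assert (Hpow : forall k, @pow_n C_Ring z k = (z ^ k)%C).
  { induction k as [|k IH]; [reflexivity|]. rewrite Cpow_S, <- IH. reflexivity. }
  assert (Hsum : forall n, @sum_n C_AbelianMonoid (fun k => scal (@pow_n C_Ring z k) (a k)) n
                   = cpoly a n z).
  { intros n. apply (sum_n_ext (G := C_AbelianMonoid)). intros k. rewrite Hpow.
    apply Cmult_comm. }
  unfold is_pseries, is_series.
  etransitivity; [apply (filterlim_locally_ball_norm (U := C_NormedModule))|].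
  split.
  - intros H eps Heps. destruct (H (mkposreal eps Heps)) as [n0 Hn0].
    exists n0. intros n Hn. rewrite <- Hsum. exact (Hn0 n Hn).
  - intros H eps. destruct (H eps (cond_pos eps)) as [n0 Hn0].
    exists n0. intros n Hn. specialize (Hn0 n Hn). rewrite <- Hsum in Hn0. exact Hn0.
Qed.

Lemma cpoly_S (a : nat -> C) (n : nat) (z : C) :
  cpoly a (S n) z = (cpoly a n z + a (S n) * z ^ S n)%C.
Proof. apply csum_S. Qed.

(** The intermediate bound [(t^n - t^(n+p)) / (1 - t)] is what makes the induction
    on [p] close. *)
Lemma cpoly_increment_geometric (a : nat -> C) (z : C) (t : R) (n : nat) :
  0 <= t < 1 ->
  (forall k, (n <= k)%nat -> Cmod (a k * z ^ k)%C <= t ^ k) ->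
  forall p, Cmod (cpoly a (n + p) z - cpoly a n z)%C <= t ^ n / (1 - t).
Proof.
  intros Ht H p.
  apply Rle_trans with ((t ^ n - t ^ (n + p)) / (1 - t)).
  - induction p as [|p IH].
    + rewrite Nat.add_0_r. replace (cpoly a n z - cpoly a n z)%C with (RtoC 0) by ring.
      rewrite Cmod_0. right. field. lra.
    + rewrite Nat.add_succ_r, cpoly_S.
      replace (cpoly a (n + p) z + a (S (n + p)) * z ^ S (n + p) - cpoly a n z)%C
        with (cpoly a (n + p) z - cpoly a n z + a (S (n + p)) * z ^ S (n + p))%C by ring.
      eapply Rle_trans; [apply Cmod_triangle|].
      assert (H1 := H (S (n + p)) ltac:(lia)).
      assert (H2 : (t ^ n - t ^ S (n + p)) / (1 - t) =
                   (t ^ n - t ^ (n + p)) / (1 - t) + t ^ (n + p)) by (simpl; field; lra).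
      assert (H3 := pow_le t (n + p) (proj1 Ht)). simpl (t ^ S _) in *. nra.
  - apply Rmult_le_compat_r; [left; apply Rinv_0_lt_compat; lra|].
    generalize (pow_le t (n + p) (proj1 Ht)). lra.
Qed.

(** Terms of a convergent series are differences of consecutive partial sums, hence
    eventually small; the bound 1 comes from partial sums within 1/2 of the limit. *)
Lemma has_expansion_terms_bounded (f : C -> C) (a : nat -> C) (rho : R) :
  has_expansion f a -> 0 <= rho < 1 ->
  exists n0, forall k, (n0 <= k)%nat -> Cmod (a k) * rho ^ k <= 1.
Proof.
  intros Hf Hrho.
  assert (Hr : Cmod rho = rho) by (rewrite Cmod_R; apply Rabs_pos_eq; lra).
  assert (H := Hf rho ltac:(unfold unit_disk; lra)).
  destruct (proj1 (is_pseries_C_iff _ _ _) H (1 / 2) ltac:(lra)) as [n0 Hn0].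
  exists (S n0). intros [|k] Hk; [lia|].
  assert (H1 := Hn0 k ltac:(lia)). assert (H2 := Hn0 (S k) ltac:(lia)).
  assert (H3 := Cmod_triangle (cpoly a (S k) rho - f rho)%C (- (cpoly a k rho - f rho))%C).
  rewrite Cmod_opp in H3. rewrite cpoly_S in H3 at 1.
  replace (cpoly a k rho + a (S k) * rho ^ S k - f rho + - (cpoly a k rho - f rho))%C
    with (a (S k) * rho ^ S k)%C in H3 by ring.
  rewrite Cmod_mult, Cmod_pow, Hr in H3. lra.
Qed.

(** Convergence at a radius [sigma] strictly between [rho] and 1 bounds the terms
    there, so on the smaller disk the series is dominated by a geometric one of ratio
    [rho / sigma]. *)
Lemma has_expansion_uniform (f : C -> C) (a : nat -> C) (rho eps : R) :
  has_expansion f a -> 0 <= rho < 1 -> 0 < eps ->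
  exists n0, forall n, (n0 <= n)%nat ->
    forall z, Cmod z <= rho -> Cmod (cpoly a n z - f z)%C <= eps.
Proof.
  intros Hf Hrho Heps.
  set (sigma := (1 + rho) / 2). set (t := rho / sigma).
  assert (Hsigma : 0 < sigma < 1) by (unfold sigma; lra).
  assert (Ht : 0 <= t < 1).
  { unfold t. split.
    - apply Rdiv_le_0_compat; lra.
    - apply (Rdiv_lt_1 rho sigma (proj1 Hsigma)). unfold sigma. lra. }
  destruct (has_expansion_terms_bounded f a sigma Hf ltac:(lra)) as [n1 Hn1].
  destruct (pow_eventually_small t (eps / 2 * (1 - t)) Ht ltac:(nra)) as [n2 Hn2].
  exists (n1 + n2)%nat. intros n Hn z Hz.
  destruct (proj1 (is_pseries_C_iff _ _ _) (Hf z ltac:(unfold unit_disk; lra)) (eps / 2)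
              ltac:(lra)) as [n3 Hn3].
  assert (H1 : Cmod (cpoly a (n + n3) z - cpoly a n z)%C <= eps / 2).
  { eapply Rle_trans; [apply (cpoly_increment_geometric a z t n Ht)|].
    - intros k Hk. rewrite Cmod_mult, Cmod_pow.
      apply Rle_trans with (Cmod (a k) * (sigma * t) ^ k).
      + apply Rmult_le_compat_l; [apply Cmod_ge_0|]. apply pow_incr.
        split; [apply Cmod_ge_0|]. replace (sigma * t) with rho by (unfold t; field; lra).
        assumption.
      + rewrite Rpow_mult_distr, <- Rmult_assoc.
        rewrite <- (Rmult_1_l (t ^ k)) at 2.
        apply Rmult_le_compat_r; [apply pow_le; lra | apply Hn1; lia].
    - apply Rle_div_l; [lra|]. left. apply Hn2. lia. }
  assert (H2 := Hn3 (n + n3)%nat ltac:(lia)).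
  assert (H3 := Cmod_triangle (cpoly a (n + n3) z - f z)%C
                  (- (cpoly a (n + n3) z - cpoly a n z))%C).
  rewrite Cmod_opp in H3.
  replace (cpoly a (n + n3) z - f z + - (cpoly a (n + n3) z - cpoly a n z))%C
    with (cpoly a n z - f z)%C in H3 by ring.
  lra.
Qed.

(** * Functions bounded by one *)

(** Coefficients of [z |-> 1 - u * f (rho * z)]; dilating by [rho < 1] makes the
    series converge uniformly on the unit circle. *)
Definition gap_coefficients (u : C) (a : nat -> C) (rho : R) : nat -> C :=
  add_constant 1 (fun k => - u * a k * rho ^ k)%C.

Lemma cpoly_gap (u : C) (a : nat -> C) (rho : R) (n : nat) (z : C) :
  cpoly (gap_coefficients u a rho) n z = (1 - u * cpoly a n (rho * z))%C.
Proof.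
  unfold gap_coefficients. rewrite cpoly_add_constant. unfold cpoly.
  rewrite (csum_ext _ (fun k => (- u) * (a k * (rho * z) ^ k))%C).
  - rewrite csum_scal_l. ring.
  - intros k. rewrite Cpow_mult_l. ring.
Qed.

(** [Re (1 - u * f) >= 1 - |f|], which is positive on the disk. *)
Lemma gap_nonneg (f : C -> C) (a : nat -> C) (u : C) (rho : R) :
  has_expansion f a -> (forall z, unit_disk z -> Cmod (f z) < 1) ->
  Cmod u = 1 -> 0 <= rho < 1 ->
  asymptotically_nonneg (gap_coefficients u a rho).
Proof.
  intros Hf Hbound Hu Hrho eps Heps.
  destruct (has_expansion_uniform f a rho eps Hf Hrho Heps) as [n0 Hn0].
  exists n0. intros n Hn z Hz. rewrite cpoly_gap.
  assert (Hrz : Cmod (rho * z)%C = rho).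
  { rewrite Cmod_mult, Hz, Cmod_R, Rabs_pos_eq; lra. }
  specialize (Hn0 n Hn (rho * z)%C ltac:(lra)).
  specialize (Hbound (rho * z)%C ltac:(unfold unit_disk; lra)).
  assert (H1 := Cmod_triangle (cpoly a n (rho * z) - f (rho * z))%C (f (rho * z))%C).
  replace (cpoly a n (rho * z) - f (rho * z) + f (rho * z))%C
    with (cpoly a n (rho * z))%C in H1 by ring.
  assert (H2 := re_le_Cmod (u * cpoly a n (rho * z))%C).
  rewrite Cmod_mult, Hu, Rmult_1_l in H2. apply Rabs_le_between in H2.
  unfold Cminus. rewrite re_plus, re_opp, re_RtoC. lra.
Qed.

Lemma left_limit_nonneg (F : R -> R) (r : R) : r < 1 -> continuity_pt F 1 ->
  (forall x, r < x < 1 -> 0 <= F x) -> 0 <= F 1.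
Proof.
  intros Hr HF H. apply Rnot_lt_le. intros Hlt.
  destruct (HF (- F 1) ltac:(lra)) as [d [Hd Hx]].
  set (x := 1 - Rmin (d / 2) ((1 - r) / 2)).
  assert (Hm : 0 < Rmin (d / 2) ((1 - r) / 2)) by (apply Rmin_glb_lt; lra).
  assert (Hm1 := Rmin_l (d / 2) ((1 - r) / 2)). assert (Hm2 := Rmin_r (d / 2) ((1 - r) / 2)).
  specialize (H x ltac:(unfold x; lra)).
  assert (Hdist : Rabs (F x - F 1) < - F 1).
  { apply Hx. split.
    - split; [exact I | unfold x; lra].
    - simpl. unfold Rdist, x. rewrite Rabs_left; lra. }
  apply Rabs_lt_between in Hdist. lra.
Qed.

(** Carathéodory's inequality for [1 - u * f], with [u] rotating [a 0] onto the
    nonnegative half-line, then [rho -> 1]. *)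
Lemma coefficient_bound (f : C -> C) (a : nat -> C) (k : nat) :
  has_expansion f a -> (forall z, unit_disk z -> Cmod (f z) < 1) -> (0 < k)%nat ->
  Cmod (a k) <= 2 * (1 - Cmod (a 0%nat)).
Proof.
  intros Hf Hbound Hk.
  destruct (exists_unit_rotation (a 0%nat)) as [u [Hu Hua]].
  apply Rminus_le_0.
  replace (2 * (1 - Cmod (a 0%nat)) - Cmod (a k))
    with (2 * (1 - Cmod (a 0%nat)) - Cmod (a k) * 1 ^ k) by (rewrite pow1; ring).
  apply (left_limit_nonneg (fun x => 2 * (1 - Cmod (a 0%nat)) - Cmod (a k) * x ^ k) 0).
  - lra.
  - reg.
  - intros x Hx.
    assert (H := caratheodory_coefficient _ k
                   (gap_nonneg f a u x Hf Hbound Hu ltac:(lra)) Hk).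
    unfold gap_coefficients in H. destruct k as [|k]; [lia|].
    cbn [add_constant] in H.
    rewrite !Cmod_mult, Cmod_opp, Hu, Cmod_pow, Cmod_R, (Rabs_pos_eq x) in H by lra.
    replace (- u * a 0%nat * x ^ 0 + 1%R)%C with (- (Cmod (a 0%nat)) + 1)%C in H
      by (rewrite <- Hua; simpl; ring).
    rewrite re_plus, re_opp, !re_RtoC in H. lra.
Qed.

(** Harnack's inequality for [1 - u * f], with [u] rotating [f z] onto the
    nonnegative half-line, then [rho -> 1]. *)
Lemma modulus_bound (f : C -> C) (a : nat -> C) (z : C) :
  has_expansion f a -> (forall z, unit_disk z -> Cmod (f z) < 1) -> Cmod z < 1 ->
  Cmod (f z) <= 1 - (1 - Cmod (a 0%nat)) * ((1 - Cmod z) / (1 + Cmod z)).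
Proof.
  intros Hf Hbound Hz. assert (Hz0 := Cmod_ge_0 z).
  destruct (exists_unit_rotation (f z)) as [u [Hu Huf]].
  set (A := Cmod (a 0%nat)). set (r := Cmod z) in *.
  assert (L : 0 <= (1 - Cmod (f z)) * (1 + r) - (1 - A) * (1 - r)).
  { apply (left_limit_nonneg (fun x => (1 - Cmod (f z)) * (x + r) - (1 - A) * (x - r)) r Hz).
    - reg.
    - intros x Hx.
      assert (HxC : RtoC x <> 0%C) by (intros H; apply RtoC_inj in H; lra).
      assert (Hs : Cmod (z / x)%C = r / x)
        by (rewrite Cmod_div, Cmod_R, Rabs_pos_eq by (assumption || lra); reflexivity).
      assert (Hrx : r / x < 1) by (apply (Rdiv_lt_1 r x); lra).
      (* The function dilated by [x] takes at [z / x] the value of [1 - u * f] at [z]. *)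
      assert (H := harnack _ (z / x)%C (1 - u * f z)%C
                     (gap_nonneg f a u x Hf Hbound Hu ltac:(lra)) ltac:(lra)).
      rewrite Hs in H. rewrite Huf in H. unfold Cminus in H.
      rewrite (re_plus 1), re_opp, !re_RtoC in H.
      assert (H0 : 1 - A <= Re (gap_coefficients u a x 0)).
      { unfold gap_coefficients. cbn [add_constant].
        assert (H1 := re_le_Cmod (u * a 0%nat)%C). apply Rabs_le_between in H1.
        rewrite Cmod_mult, Hu, Rmult_1_l in H1. fold A in H1.
        replace (- u * a 0%nat * x ^ 0 + 1%R)%C with (- (u * a 0%nat) + 1)%C
          by (simpl; ring).
        rewrite re_plus, re_opp, re_RtoC. lra. }
      assert (H2 : (1 - r / x) / (1 + r / x) = (x - r) / (x + r)) by (field; lra).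
      rewrite H2 in H.
      assert (H3 : (x - r) / (x + r) * Re (gap_coefficients u a x 0) <= 1 - Cmod (f z)).
      { apply H. intros eps Heps.
        destruct (has_expansion_uniform f a r eps Hf ltac:(lra) Heps) as [n0 Hn0].
        exists n0. intros n Hn. rewrite cpoly_gap.
        replace (x * (z / x))%C with z by (field; assumption).
        rewrite <- Huf.
        replace (1 - u * cpoly a n z + - (1 + - (u * f z)))%C
          with (- (u * (cpoly a n z - f z)))%C by ring.
        rewrite Cmod_opp, Cmod_mult, Hu, Rmult_1_l. apply Hn0; [assumption|].
        apply Rle_refl. }
      assert (H4 : (x - r) * Re (gap_coefficients u a x 0) <= (1 - Cmod (f z)) * (x + r)).
      { replace ((x - r) * Re (gap_coefficients u a x 0))
          with ((x - r) / (x + r) * Re (gap_coefficients u a x 0) * (x + r)) by (field; lra).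
        apply Rmult_le_compat_r; lra. }
      nra. }
  apply Rmult_le_reg_r with (1 + r); [lra|].
  replace ((1 - (1 - A) * ((1 - r) / (1 + r))) * (1 + r))
    with (1 + r - (1 - A) * (1 - r)) by (field; lra).
  lra.
Qed.

(** * The inequality inside the radius *)

(** With [S = alpha + beta] and [d] the square root of the reduced discriminant, the
    polynomial factors as [(1 - (S + d) r) (1 + (d - S) r)] and the radius is
    [1 / (S + d)], in the degenerate linear case too.  The discriminant exceeds
    [(S - 1)^2] by [4 beta > 0], so [d - S > -1] and the second factor is positive
    for [r < 1]. *)
Lemma bohr_radius_sign (alpha beta r : R) :
  0 < alpha <= 1 -> 1 - alpha < beta -> 0 <= r < 1 ->
  exists q, 0 < q /\
    1 - 2 * (alpha + beta) * r - (1 + 2 * beta - 2 * alpha) * r ^ 2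
    = q * (bohr_radius alpha beta - r).
Proof.
  intros Ha Hb Hr.
  set (S := alpha + beta). set (A := 1 + 2 * beta - 2 * alpha).
  assert (HS : 1 < S) by (unfold S; lra).
  assert (HSA : (S - 1) ^ 2 < S ^ 2 + A) by (unfold S, A; lra).
  set (d := sqrt (S ^ 2 + A)).
  assert (Hd2 : d * d = S ^ 2 + A) by (apply sqrt_sqrt; nra).
  assert (Hd : S - 1 < d).
  { unfold d. rewrite <- (sqrt_pow2 (S - 1)) by lra. apply sqrt_lt_1; nra. }
  assert (HR : bohr_radius alpha beta = 1 / (S + d)).
  { unfold bohr_radius. destruct (Req_EM_T beta (alpha - 1 / 2)) as [He|He].
    - assert (HA : A = 0) by (unfold A; lra).
      assert (HdS : d = S).
      { unfold d. rewrite HA, Rplus_0_r. apply sqrt_pow2. lra. }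
      rewrite HdS. f_equal. unfold S. lra.
    - fold S. fold A. fold d.
      assert (HA : A <> 0) by (unfold A; lra).
      assert (HAd : A = (d - S) * (d + S)) by nra.
      assert (Hds : d - S <> 0) by (intros H0; apply HA; rewrite HAd, H0; ring).
      rewrite HAd. field. split; lra. }
  exists ((S + d) * (1 + (d - S) * r)). split.
  - apply Rmult_lt_0_compat; [lra|]. nra.
  - rewrite HR. transitivity ((1 - (S + d) * r) * (1 + (d - S) * r)).
    + assert (E : (1 - (S + d) * r) * (1 + (d - S) * r)
                  = 1 - 2 * S * r - (d * d - S ^ 2) * r ^ 2) by ring.
      rewrite E, Hd2. ring.
    + field. lra.
Qed.

(** Inserting the two bounds, [1 - bohr_sum] is at least [1 - |a_0|] times
    [alpha (1-r)/(1+r) + 1 - alpha - 2 beta r/(1-r)], whose numerator over the common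
    denominator is the polynomial of [bohr_radius_sign]. *)
Lemma bohr_sum_le_1 (alpha beta : R) (f : C -> C) (a : nat -> C) (z : C) :
  0 < alpha <= 1 -> 1 - alpha < beta -> BA f -> has_expansion f a ->
  Cmod z < 1 -> Cmod z <= bohr_radius alpha beta ->
  bohr_sum alpha beta f a z <= 1.
Proof.
  intros Ha Hb [_ Hbound] Hf Hz HzR. unfold bohr_sum.
  assert (Hr0 := Cmod_ge_0 z).
  assert (Hmod := modulus_bound f a z Hf Hbound Hz).
  assert (Hcoef := fun k => coefficient_bound f a (S k) Hf Hbound (Nat.lt_0_succ k)).
  assert (Ha1 : 0 <= 1 - Cmod (a 0%nat)).
  { generalize (Hcoef 0%nat) (Cmod_ge_0 (a 1%nat)). lra. }
  destruct (bohr_radius_sign alpha beta (Cmod z) Ha Hb (conj Hr0 Hz)) as [q [Hq Eq]].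
  revert Hmod Hz HzR Hr0 Hq Eq. set (r := Cmod z). set (A := Cmod (a 0%nat)) in *.
  set (F := Cmod (f z)). intros Hmod Hz HzR Hr0 Hq Eq.
  assert (Hser : Series (fun k => Cmod (a (S k)) * r ^ S k) <= (1 - A) * (2 * r / (1 - r))).
  { assert (Hr : Rabs r < 1) by (rewrite Rabs_pos_eq; lra).
    replace ((1 - A) * (2 * r / (1 - r)))
      with (Series (fun k => 2 * (1 - A) * r * r ^ k))
      by (rewrite Series_scal_l, Series_geom by assumption; field; lra).
    apply Series_le.
    - intros k. assert (Hp := pow_le r k Hr0). assert (Hk := Hcoef k).
      assert (Hk0 := Cmod_ge_0 (a (S k))). simpl. split.
      + apply Rmult_le_pos; [assumption|]. now apply Rmult_le_pos.
      + rewrite Rmult_assoc. apply Rmult_le_compat_r; [|assumption].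
        now apply Rmult_le_pos.
    - apply (ex_series_scal_l (V := R_NormedModule)). now apply ex_series_geom. }
  apply Rle_trans with
    (alpha * (1 - (1 - A) * ((1 - r) / (1 + r))) + (1 - alpha) * A
     + beta * ((1 - A) * (2 * r / (1 - r)))).
  - apply Rplus_le_compat; [apply Rplus_le_compat_r|]; apply Rmult_le_compat_l; lra.
  - apply Rminus_le_0.
    replace (1 - _) with ((1 - A) * (q * (bohr_radius alpha beta - r)) / ((1 + r) * (1 - r)))
      by (rewrite <- Eq; field; lra).
    apply Rdiv_le_0_compat; [|nra].
    apply Rmult_le_pos; [assumption|]. apply Rmult_le_pos; lra.
Qed.

(** * Sharpness *)

Definition mobius (a : R) (z : C) : C := ((a - z) / (1 - a * z))%C.

Definition mobius_coefficient (a : R) (k : nat) : C :=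
  match k with 0%nat => RtoC a | S j => RtoC (- ((1 - a ^ 2) * a ^ j)) end.

Lemma Cmod_scaled_lt (a : R) (z : C) : 0 < a < 1 -> Cmod z < 1 -> Cmod (a * z)%C < a.
Proof.
  intros Ha Hz. rewrite Cmod_mult, Cmod_R, Rabs_pos_eq by lra.
  generalize (Cmod_ge_0 z). nra.
Qed.

(** [|1 - a z|^2 - |a - z|^2 = (1 - a^2) (1 - |z|^2)]. *)
Lemma mobius_lt_1 (a : R) (z : C) : 0 < a < 1 -> Cmod z < 1 -> Cmod (mobius a z) < 1.
Proof.
  intros Ha Hz. assert (Haz := Cmod_scaled_lt a z Ha Hz).
  assert (Hne := C_one_minus_neq0 (a * z)%C ltac:(lra)).
  unfold mobius. rewrite Cmod_div by assumption.
  apply (Rdiv_lt_1 _ _ (proj1 (Cmod_gt_0 _) Hne)).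
  apply Rsqr_incrst_0; try apply Cmod_ge_0.
  assert (H0 := Cmod_ge_0 z).
  rewrite !Rsqr_pow2, !Cmod2_alt.
  assert (Hz2 : Re z ^ 2 + Im z ^ 2 < 1) by (rewrite <- Cmod2_alt; nra).
  assert (Hprod : 0 < (1 - a ^ 2) * (1 - (Re z ^ 2 + Im z ^ 2))).
  { apply Rmult_lt_0_compat; nra. }
  clear - Hprod. destruct z as [x y]. simpl in *. lra.
Qed.

Lemma mobius_expansion (a : R) : 0 < a < 1 -> has_expansion (mobius a) (mobius_coefficient a).
Proof.
  intros Ha z Hz. apply is_pseries_C_iff. intros eps Heps. unfold unit_disk in Hz.
  assert (Haz := Cmod_scaled_lt a z Ha Hz).
  assert (Hne := C_one_minus_neq0 (a * z)%C ltac:(lra)).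
  destruct (pow_eventually_small a (eps * (1 - a)) ltac:(lra) ltac:(nra)) as [n0 Hn0].
  exists (S n0). intros [|n] Hn; [lia|].
  (* The tail of the geometric series in [a z]. *)
  assert (E : (cpoly (mobius_coefficient a) (S n) z - mobius a z
     = RtoC (1 - a ^ 2) * z * ((a * z) ^ S n / (1 - a * z)))%C).
  { unfold cpoly. rewrite csum_first.
    rewrite (csum_ext _ (fun k => (- RtoC (1 - a ^ 2) * z) * (a * z) ^ k)%C).
    - rewrite csum_scal_l, geom_csum_closed by lra. unfold mobius, mobius_coefficient.
      simpl (z ^ 0)%C. rewrite RtoC_minus, RtoC_pow. field. assumption.
    - intros k. unfold mobius_coefficient.
      rewrite RtoC_opp, RtoC_mult, RtoC_pow, Cpow_mult_l, Cpow_S. ring. }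
  rewrite E, !Cmod_mult, Cmod_div, Cmod_pow, Cmod_R by assumption.
  rewrite Rabs_pos_eq by nra.
  assert (H1 := Cmod_one_minus (a * z)%C).
  assert (H2 : Cmod (a * z)%C ^ S n / Cmod (1 - a * z)%C < eps).
  { apply Rlt_div_l; [lra|].
    apply Rle_lt_trans with (a ^ S n).
    - apply pow_incr. split; [apply Cmod_ge_0 | lra].
    - specialize (Hn0 (S n) ltac:(lia)). nra. }
  assert (H3 : 0 <= Cmod (a * z)%C ^ S n / Cmod (1 - a * z)%C).
  { apply Rdiv_le_0_compat; [apply pow_le, Cmod_ge_0 | lra]. }
  assert (H4 : 0 <= (1 - a ^ 2) * Cmod z <= 1).
  { assert (H0 := Cmod_ge_0 z). split; [apply Rmult_le_pos; nra|].
    rewrite <- (Rmult_1_l 1). apply Rmult_le_compat; nra. }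
  nra.
Qed.

Lemma is_derive_C_of_quadratic_bound (f : C -> C) (z l : C) (d M : R) :
  0 < d -> 0 < M ->
  (forall w, Cmod (w - z)%C < d ->
     Cmod (f w - f z - (w - z) * l)%C <= M * Cmod (w - z)%C ^ 2) ->
  @is_derive C_AbsRing C_NormedModule f z l.
Proof.
  intros Hd HM H. split; [apply (is_linear_scal_l (V := C_NormedModule))|].
  intros x Hx.
  rewrite <- (is_filter_lim_locally_unique (V := AbsRing_NormedModule C_AbsRing) z x Hx).
  clear x Hx.
  intros eps. apply (locally_le_locally_norm (V := AbsRing_NormedModule C_AbsRing)).
  assert (He : 0 < Rmin d (eps / M)).
  { apply Rmin_glb_lt; [assumption|]. apply Rdiv_lt_0_compat; [apply cond_pos|assumption]. }
  exists (mkposreal _ He). intros w Hw.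
  change (Cmod (w - z)%C < Rmin d (eps / M)) in Hw.
  change (Cmod (f w - f z - (w - z) * l)%C <= eps * Cmod (w - z)%C).
  assert (Hw1 := Rlt_le_trans _ _ _ Hw (Rmin_l _ _)).
  assert (Hw2 := Rlt_le_trans _ _ _ Hw (Rmin_r _ _)).
  eapply Rle_trans; [apply H; assumption|].
  replace (M * Cmod (w - z)%C ^ 2) with (M * Cmod (w - z)%C * Cmod (w - z)%C) by ring.
  apply Rmult_le_compat_r; [apply Cmod_ge_0|].
  apply Rlt_le. rewrite Rmult_comm. now apply Rlt_div_r.
Qed.

Lemma mobius_analytic (a : R) : 0 < a < 1 -> analytic_on_disk (mobius a).
Proof.
  intros Ha z Hz. unfold unit_disk in Hz.
  exists (- RtoC (1 - a ^ 2) / (1 - a * z) ^ 2)%C.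
  apply (is_derive_C_of_quadratic_bound _ _ _ (1 - Cmod z) (1 / (1 - a) ^ 3)).
  - lra.
  - apply Rdiv_lt_0_compat; [lra|]. apply pow_lt. lra.
  - intros w Hw.
    assert (Hw1 : Cmod w < 1).
    { assert (H := Cmod_triangle (w - z)%C z).
      replace (w - z + z)%C with w in H by ring. lra. }
    assert (Haz := Cmod_scaled_lt a z Ha Hz).
    assert (Haw := Cmod_scaled_lt a w Ha Hw1).
    assert (Hnz := C_one_minus_neq0 (a * z)%C ltac:(lra)).
    assert (Hnw := C_one_minus_neq0 (a * w)%C ltac:(lra)).
    (* The remainder of the first-order expansion has the factor [(w - z) ^ 2], and
       its denominators are at least [1 - a] in modulus. *)
    assert (E : (mobius a w - mobius a z - (w - z) * (- RtoC (1 - a ^ 2) / (1 - a * z) ^ 2)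
       = RtoC (- ((1 - a ^ 2) * a)) * (w - z) ^ 2 / ((1 - a * w) * (1 - a * z) ^ 2))%C).
    { unfold mobius. rewrite RtoC_opp, RtoC_mult, RtoC_minus, RtoC_pow. field. split; assumption. }
    assert (Bz := Cmod_one_minus (a * z)%C). assert (Bw := Cmod_one_minus (a * w)%C).
    rewrite E, Cmod_div, !Cmod_mult, !Cmod_pow, Cmod_R, Rabs_Ropp, Rabs_pos_eq.
    + unfold Rdiv. rewrite Rmult_1_l, Rmult_assoc, (Rmult_comm (Cmod _ ^ 2)), <- Rmult_assoc.
      apply Rmult_le_compat_r; [apply pow2_ge_0|].
      rewrite <- (Rmult_1_l (/ (1 - a) ^ 3)).
      assert (P : 0 < (1 - a) ^ 3) by (apply pow_lt; lra).
      assert (Q : (1 - a) ^ 3 <= Cmod (1 - a * w)%C * Cmod (1 - a * z)%C ^ 2).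
      { replace ((1 - a) ^ 3) with ((1 - a) * (1 - a) ^ 2) by ring.
        apply Rmult_le_compat; try lra; [apply pow2_ge_0|]. apply pow_incr. lra. }
      apply Rmult_le_compat; try nra.
      * left. apply Rinv_0_lt_compat. lra.
      * now apply Rinv_le_contravar.
    + assert (0 < 1 - a ^ 2) by nra. nra.
    + intros H. apply Hnw.
      transitivity ((1 - a * w) * (1 - a * z) ^ 2 / (1 - a * z) ^ 2)%C; [field; assumption|].
      rewrite H. field. assumption.
Qed.

(** At [- r] the modulus of [mobius a] is largest on the circle of radius [r]. *)
Lemma mobius_bohr_sum (alpha beta a r : R) : 0 < a < 1 -> 0 < r < 1 ->
  bohr_sum alpha beta (mobius a) (mobius_coefficient a) (- r)%C
  = alpha * ((a + r) / (1 + a * r)) + (1 - alpha) * a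
    + beta * ((1 - a ^ 2) * r / (1 - a * r)).
Proof.
  intros Ha Hr. unfold bohr_sum.
  assert (Hne : 1 + a * r <> 0) by nra.
  assert (Hne' : 1 - a * r <> 0) by nra.
  rewrite Cmod_opp, (Cmod_R r), (Rabs_pos_eq r) by lra.
  replace (mobius a (- r)%C) with (RtoC ((a + r) / (1 + a * r))).
  - simpl mobius_coefficient at 1. rewrite !Cmod_R.
    rewrite (Rabs_pos_eq ((a + r) / (1 + a * r))) by (apply Rdiv_le_0_compat; nra).
    rewrite (Rabs_pos_eq a) by lra. f_equal. f_equal.
    rewrite (Series_ext _ (fun k => (1 - a ^ 2) * r * (a * r) ^ k)).
    + rewrite Series_scal_l, Series_geom by (rewrite Rabs_pos_eq; nra). reflexivity.
    + intros k. unfold mobius_coefficient. rewrite Cmod_R, Rabs_Ropp, Rabs_pos_eq.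
      * rewrite Rpow_mult_distr. simpl. ring.
      * apply Rmult_le_pos; [nra|]. apply pow_le. lra.
  - unfold mobius. rewrite RtoC_div, !RtoC_plus, RtoC_mult by assumption.
    replace (a - - r)%C with (a + r)%C by ring.
    replace (1 - a * - r)%C with (1 + a * r)%C by ring. reflexivity.
Qed.

(** [bohr_sum - 1] equals [1 - a] times a quantity of the sign of [- G a].  As
    [a -> 1], [G a] tends to the polynomial of [bohr_radius_sign], which is negative
    beyond the radius; by continuity [G a] is negative for some [a < 1]. *)
Lemma bohr_radius_sharp (alpha beta r : R) :
  0 < alpha <= 1 -> 1 - alpha < beta -> bohr_radius alpha beta < r < 1 -> 0 < r ->
  exists a, 0 < a < 1 /\
    1 < bohr_sum alpha beta (mobius a) (mobius_coefficient a) (- r)%C.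
Proof.
  intros Ha Hb Hr Hr0.
  set (G := fun a => (alpha * (1 - r) + (1 - alpha) * (1 + r * a)) * (1 - a * r)
                     - beta * (1 + a) * r * (1 + r * a)).
  assert (HG1 : G 1 < 0).
  { destruct (bohr_radius_sign alpha beta r Ha Hb ltac:(lra)) as [q [Hq Eq]].
    replace (G 1) with (q * (bohr_radius alpha beta - r)) by (rewrite <- Eq; unfold G; ring).
    nra. }
  assert (HG : exists a, 0 < a < 1 /\ G a < 0).
  { apply NNPP. intros Hno. apply (Rlt_not_le _ _ HG1).
    apply (left_limit_nonneg G 0); [lra | unfold G; reg |].
    intros x Hx. apply Rnot_lt_le. intros HGx. apply Hno. now exists x. }
  destruct HG as [a [Ha01 HGa]]. exists a. split; [assumption|].
  rewrite mobius_bohr_sum by lra. apply Rlt_0_minus.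
  assert (Hne : 0 < 1 + a * r) by nra.
  assert (Hne' : 0 < 1 - a * r) by nra.
  replace (_ - 1) with ((1 - a) * (- G a) / ((1 + a * r) * (1 - a * r)))
    by (unfold G; field; lra).
  apply Rdiv_lt_0_compat; apply Rmult_lt_0_compat; lra.
Qed.

Theorem theorem3p1 (alpha beta : R)
  (halpha : 0 < alpha <= 1) (hbeta : 1 - alpha < beta) :
  (forall (f : C -> C) (a : nat -> C), BA f -> has_expansion f a ->
     forall z : C, Cmod z < 1 -> Cmod z <= bohr_radius alpha beta ->
       bohr_sum alpha beta f a z <= 1)
  /\
  (forall r : R, bohr_radius alpha beta < r < 1 ->
     exists (f : C -> C) (a : nat -> C) (z : C),
       BA f /\ has_expansion f a /\ Cmod z = r /\
       ~ bohr_sum alpha beta f a z <= 1).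
Proof.
  split.
  - intros f a Hf Ha z Hz HzR. now apply bohr_sum_le_1.
  - intros r Hr.
    assert (Hr0 : 0 < r).
    { destruct (bohr_radius_sign alpha beta 0 halpha hbeta ltac:(lra)) as [q [Hq Eq]]. nra. }
    destruct (bohr_radius_sharp alpha beta r halpha hbeta Hr Hr0) as [a [Ha Hsum]].
    exists (mobius a), (mobius_coefficient a), (- r)%C.
    repeat split.
    + now apply mobius_analytic.
    + intros z Hz. now apply mobius_lt_1.
    + now apply mobius_expansion.
    + rewrite Cmod_opp, Cmod_R. apply Rabs_pos_eq. lra.
    + lra.
Qed.
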